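(* There is a polynomial $p$ such that the following holds. Let $X$ be a nonempty finite set, $\eta,\varepsilon\in(0,1)$, $n\ge1$, $f:X^n\to\{0,1\}$, $\mathcal D$ a distribution on $X$, and $m\ge p(n,1/\varepsilon,\ln(|X|+1))$ an integer; set $f'=f\circ\Phi_{m\to n}$. Then the four quantities $$\mathrm{ObliviousAddMax}_\eta(f,\mathcal D),\quad\mathrm{AdaptiveAddMax}_\eta(f',\mathcal D),\quad\mathrm{MalMax}_\eta(f',\mathcal D),\quad\mathrm{NonIIDMax}_\eta(f',\mathcal D)$$ are pairwise within $\varepsilon$ of one another.
   Context: $\Phi_{m\to n}$ outputs the entries of its input $S\in X^m$ at a uniformly random sequence of $n$ distinct indices. $\mathrm{add}_\eta(\mathcal D)=\{(1-\eta)\mathcal D+\eta\mathcal E:\mathcal E\text{ a distribution on }X\}$ and $\mathrm{ObliviousAddMax}_\eta(f,\mathcal D)=\sup_{\mathcal D'\in\mathrm{add}_\eta(\mathcal D)}\mathbb E_{S\sim(\mathcal D')^n}[f(S)]$. For $S\in X^{\lceil(1-\eta)m\rceil}$, $\mathrm{add}_\eta(S)$ is the set of samples in $X^m$ obtained by adding $\lfloor\eta m\rfloor$ arbitrary points to $S$ and arbitrarily permuting, and $\mathrm{AdaptiveAddMax}_\eta(g,\mathcal D)=\mathbb E_{S\sim\mathcal D^{\lceil(1-\eta)m\rceil}}[\sup_{S'\in\mathrm{add}_\eta(S)}\mathbb E[g(S')]]$ for randomized $g:X^m\to\{0,1\}$. Malicious noise with rate $\eta$ generates $x_1,\dots,x_m$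 sequentially: for each $i$, independently with probability $1-\eta$, $x_i\sim\mathcal D$; otherwise the adversary chooses $x_i$ arbitrarily as a function of $x_1,\dots,x_{i-1}$ (and its own randomness) but without knowledge of future points; $\mathrm{MalMax}_\eta(g,\mathcal D)$ is the supremum over such adversaries of $\mathbb E[g(x_1,\dots,x_m)]$. The non-i.i.d. adversary with rate $\eta$ first chooses $\lfloor\eta m\rfloor$ arbitrary points (without seeing the clean data), then $\lceil(1-\eta)m\rceil$ i.i.d. points from $\mathcal D$ are added and the resulting $m$ points are arbitrarily permuted; $\mathrm{NonIIDMax}_\eta(g,\mathcal D)$ is the supremum over such adversaries of the expectation of $g$ on the resulting sample. *)

(* Defs.v *)
From HB Require Import structures.
From mathcomp Require Import all_boot all_order all_algebra all_fingroup.
From mathcomp Require Import all_classical all_reals all_analysis.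
Set Implicit Arguments. Unset Strict Implicit. Unset Printing Implicit Defensive.
Import Order.TTheory GRing.Theory Num.Theory.
Local Open Scope ring_scope.
Local Open Scope classical_set_scope.

Section Defs.
Variable R : realType.

Definition poly3 := seq (R * (nat * nat * nat)).
Definition peval3 (p : poly3) (a b c : R) : R :=
  \sum_(t <- p) t.1 * a ^+ t.2.1.1 * b ^+ t.2.1.2 * c ^+ t.2.2.

Variable X : finType.

Definition is_dist (D : {ffun X -> R}) : Prop :=
  (forall x, 0 <= D x) /\ \sum_x D x = 1.

Definition mixd (eta : R) (D E : {ffun X -> R}) : {ffun X -> R} :=
  [ffun x => (1 - eta) * D x + eta * E x].

Definition expect_iid (k : nat) (D : {ffun X -> R}) (g : {ffun 'I_k -> X} -> R) : R :=
  \sum_(S : {ffun 'I_k -> X}) (\prod_(i < k) D (S i)) * g S.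

Definition injs (n m : nat) : {set {ffun 'I_n -> 'I_m}} :=
  [set s : {ffun 'I_n -> 'I_m} | injectiveb s].

(* f' = f o Phi_{m -> n}; a randomized {0,1}-valued function on X^m is represented
   by its acceptance probability  E[f'(S)] = P_{sigma uniform}(f (S o sigma) = 1). *)
Definition compPhi (n m : nat) (f : {ffun 'I_n -> X} -> bool) (S : {ffun 'I_m -> X}) : R :=
  (#|injs n m|%:R)^-1 *
    \sum_(s in injs n m) ((f [ffun i => S (s i)]) : nat)%:R.

Definition floorn (x : R) : nat := `|Num.floor x|%N.
Definition ceiln (x : R) : nat := `|Num.ceil x|%N.

(* The merge of clean points S (placed at the positions tau, injective) with
   adversarial points Z (occupying all remaining positions).  The samples
   obtained by adding floor(eta m) points to S (of size ceil((1-eta) m)) and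
   permuting are exactly the merge tau S Z. *)
Definition merge (k m : nat) (tau : {ffun 'I_k -> 'I_m}) (S : {ffun 'I_k -> X})
  (Z : {ffun 'I_m -> X}) : {ffun 'I_m -> X} :=
  [ffun i => if [pick j | tau j == i] is Some j then S j else Z i].

Definition ObliviousAddMax (eta : R) (n : nat) (f : {ffun 'I_n -> X} -> bool)
  (D : {ffun X -> R}) : R :=
  sup [set y | exists E, is_dist E /\
                 y = expect_iid (mixd eta D E) (fun S => ((f S) : nat)%:R)].

(* sup over S' in add_eta(S) of E[g(S')] is a max over a finite nonempty set of
   values in [0,1]; we write it as a big max starting from 0. *)
Definition AdaptiveAddMax (eta : R) (m : nat) (g : {ffun 'I_m -> X} -> R)
  (D : {ffun X -> R}) : R :=
  let k := ceiln ((1 - eta) * m%:R) in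
  expect_iid (k := k) D (fun S =>
    \big[Num.max/0]_(tZ : {ffun 'I_k -> 'I_m} * {ffun 'I_m -> X}
                      | injectiveb tZ.1) g (merge tZ.1 S tZ.2)).

(* Malicious noise: the adversary's (behavioural) strategy gives at step i a
   distribution on X depending only on x_1..x_{i-1}; with probability 1-eta the
   point is drawn from D, otherwise from the adversary's choice. *)
Definition mal_adversary (m : nat) (A : 'I_m -> {ffun 'I_m -> X} -> {ffun X -> R}) : Prop :=
  (forall i h, is_dist (A i h)) /\
  (forall (i : 'I_m) (h h' : {ffun 'I_m -> X}), (forall j : 'I_m, (j < i)%N -> h j = h' j) -> A i h = A i h').

Definition MalMax (eta : R) (m : nat) (g : {ffun 'I_m -> X} -> R) (D : {ffun X -> R}) : R :=
  sup [set y | exists A, mal_adversary A /\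
    y = \sum_(x : {ffun 'I_m -> X})
          (\prod_(i < m) ((1 - eta) * D (x i) + eta * A i x (x i))) * g x].

(* Non-i.i.d. adversary: chooses (obliviously) the corrupted points and the
   arrangement, i.e. the positions tau of the ceil((1-eta)m) clean points and
   the values Z at the other floor(eta m) positions. *)
Definition NonIIDMax (eta : R) (m : nat) (g : {ffun 'I_m -> X} -> R) (D : {ffun X -> R}) : R :=
  let k := ceiln ((1 - eta) * m%:R) in
  sup [set y | exists (tau : {ffun 'I_k -> 'I_m}) (Z : {ffun 'I_m -> X}),
                 injective tau /\ y = expect_iid D (fun S => g (merge tau S Z))].

End Defs.

(* Main.v *)
Require Import Defs.
From HB Require Import structures.
From mathcomp Require Import all_boot all_order all_algebra all_fingroup.
From mathcomp Require Import all_classical all_reals all_analysis.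
From mathcomp Require Import ring lra zify.
Import Order.TTheory GRing.Theory Num.Theory.
Local Open Scope ring_scope.
Set Implicit Arguments. Unset Strict Implicit. Unset Printing Implicit Defensive.

(**
  Write F(P) for the acceptance probability of f on n i.i.d. points of law P.
  Up to n^2/m, the chance that n random indices among m collide, f'(x) equals
  F(empirical measure of x), and the expectation of F over a random mixture
  (1/m) sum_i P_i with independent P_i equals F(mean of the mixture).

  Both the malicious and the adaptive adversary are dominated by one that sees
  all clean points before choosing the corrupted ones, whose empirical measure
  is some distribution W.  Replacing W by the uniform measure on t points drawn
  from it costs n^2/t and leaves |X|^t candidates.  For each candidate the value
  is a function of m independent variables with differences at most 2n/m, so
  exponential moments give a maximal inequality: the expected maximum over the
  candidates exceeds the maximal expectation by at most
  t ln|X| / lam + 8 lam n^2 / m, and every expectation is at most the oblivious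
  value up to n^2/m.  Conversely, the oblivious adversary with corruption E is
  simulated exactly by a malicious one, and up to O(n^2/m) by drawing the points
  of the non-i.i.d. adversary from E.
*)

(** * Finite product expectations and resampling of coordinates *)

Section ProductExpectation.
Variable R : realType.

Definition prob (T : finType) (p : T -> R) : Prop :=
  (forall a, 0 <= p a) /\ \sum_a p a = 1.

(** The laws may vary with the coordinate; for a constant family this unfolds to [expect_iid]. *)
Definition pexp (I T : finType) (mu : I -> T -> R) (h : {ffun I -> T} -> R) : R :=
  \sum_(w : {ffun I -> T}) (\prod_i mu i (w i)) * h w.

(* [Defs.merge] over arbitrary finite index types. *)
Definition overwrite (K I T : finType) (tau : K -> I) (S : {ffun K -> T})
    (w : {ffun I -> T}) : {ffun I -> T} :=
  [ffun i => if [pick j | tau j == i] is Some j then S j else w i].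

Lemma prob_delta (T : finType) (y : T) : prob (fun x => (y == x)%:R).
Proof.
split=> [a|]; first exact: ler0n.
rewrite (bigD1 y) //= eqxx big1 ?addr0 // => a.
by rewrite eq_sym => /negbTE ->.
Qed.

Section Basics.
Variables (I T : finType) (mu : I -> T -> R).
Hypothesis muP : forall i, prob (mu i).

Lemma weight_ge0 (w : {ffun I -> T}) : 0 <= \prod_i mu i (w i).
Proof. by apply: prodr_ge0 => i _; case: (muP i). Qed.

Lemma weight_sum1 : \sum_(w : {ffun I -> T}) \prod_i mu i (w i) = 1.
Proof.
rewrite -(bigA_distr_bigA mu) big1 // => i _; by case: (muP i).
Qed.

Lemma pexp_cst c : pexp mu (fun=> c) = c.
Proof. by rewrite /pexp -mulr_suml weight_sum1 mul1r. Qed.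

Lemma ler_pexp g h : (forall w, g w <= h w) -> pexp mu g <= pexp mu h.
Proof. by move=> gh; apply: ler_sum => w _; rewrite ler_wpM2l ?weight_ge0. Qed.

Lemma pexp_le c h : (forall w, h w <= c) -> pexp mu h <= c.
Proof. by move=> hc; rewrite -[leRHS]pexp_cst; exact: ler_pexp. Qed.

Lemma pexp_ge0 h : (forall w, 0 <= h w) -> 0 <= pexp mu h.
Proof. by move=> hc; rewrite -[leLHS](pexp_cst 0); exact: ler_pexp. Qed.

Lemma eq_pexp g h : g =1 h -> pexp mu g = pexp mu h.
Proof. by move=> gh; apply: eq_bigr => w _; rewrite gh. Qed.

Lemma pexpZ c h : pexp mu (fun w => c * h w) = c * pexp mu h.
Proof. by rewrite /pexp mulr_sumr; apply: eq_bigr => w _; rewrite mulrCA. Qed.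

Lemma pexpD g h : pexp mu (fun w => g w + h w) = pexp mu g + pexp mu h.
Proof. by rewrite /pexp -big_split; apply: eq_bigr => w _; rewrite mulrDr. Qed.

Lemma pexp_sum (J : Type) (r : seq J) (P : pred J) (h : J -> {ffun I -> T} -> R) :
  pexp mu (fun w => \sum_(j <- r | P j) h j w) = \sum_(j <- r | P j) pexp mu (h j).
Proof.
rewrite /pexp exchange_big; apply: eq_bigr => w _; by rewrite mulr_sumr.
Qed.

Lemma pexp_exists h (w0 : {ffun I -> T}) : exists w, pexp mu h <= h w.
Proof.
case: (@arg_maxP _ _ _ w0 xpredT h isT) => w _ hw; exists w.
by apply: pexp_le => v; exact: hw.
Qed.

End Basics.

Lemma eq_pexp_mu (I T : finType) (mu nu : I -> T -> R) h :
  (forall i, mu i =1 nu i) -> pexp mu h = pexp nu h.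
Proof.
by move=> e; apply: eq_bigr => w _; congr (_ * _); apply: eq_bigr => i _; rewrite e.
Qed.

Section Overwrite.
Variables (K I T : finType) (tau : K -> I).
Hypothesis tau_inj : injective tau.

Lemma overwrite_in S (w : {ffun I -> T}) j : overwrite tau S w (tau j) = S j.
Proof.
rewrite ffunE; case: pickP => [j' /eqP /tau_inj -> //|/(_ j)]; by rewrite eqxx.
Qed.

Lemma overwrite_out S (w : {ffun I -> T}) i :
  i \notin codom tau -> overwrite tau S w i = w i.
Proof.
move=> ni; rewrite ffunE; case: pickP => [j' /eqP e|//].
by rewrite -e codom_f in ni.
Qed.

Lemma overwrite_comp S (w : {ffun I -> T}) : [ffun j => overwrite tau S w (tau j)] = S.
Proof. by apply/ffunP => j; rewrite ffunE overwrite_in. Qed.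

Lemma big_codom_split (idx : R) (op : Monoid.com_law idx) (F : I -> R) :
  \big[op/idx]_i F i =
  op (\big[op/idx]_j F (tau j)) (\big[op/idx]_(i | i \notin codom tau) F i).
Proof.
rewrite (bigID (mem (codom tau))) /=; congr (op _ _).
transitivity (\big[op/idx]_(i <- codom tau) F i); last by rewrite big_image.
by rewrite big_uniq //; apply/injectiveP.
Qed.

(* Swapping the coordinates [w \o tau] with the fresh sample [S] is an
   involution which preserves the product weight. *)
Lemma pexp_overwrite (mu : I -> T -> R) (h : {ffun I -> T} -> R) :
  (forall i, prob (mu i)) ->
  pexp mu (fun w => pexp (fun j => mu (tau j)) (fun S => h (overwrite tau S w)))
  = pexp mu h.
Proof.
move=> muP.
pose sw (p : {ffun I -> T} * {ffun K -> T}) :=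
  (overwrite tau p.2 p.1, [ffun j => p.1 (tau j)]).
have swK : involutive sw.
  move=> [w S]; rewrite /sw /= overwrite_comp; congr (_, _).
  apply/ffunP => i; have [/codomP[j ->]|ni] := boolP (i \in codom tau).
    by rewrite overwrite_in ffunE.
  by rewrite !overwrite_out.
(* Padding the right side with an independent sample [S] makes both sides sums over pairs, which
   [sw] reindexes. *)
have -> : pexp mu h = pexp mu (fun w => pexp (fun j => mu (tau j)) (fun=> h w)).
  by apply: eq_pexp => w; rewrite pexp_cst.
rewrite /pexp; under eq_bigr do rewrite mulr_sumr.
under [RHS]eq_bigr do rewrite mulr_sumr.
rewrite !pair_bigA /= [RHS](reindex_inj (inv_inj swK)) /=.
apply: eq_bigr => -[w S] _ /=; rewrite !mulrA; congr (_ * _).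
rewrite 2!(big_codom_split _) /=.
have -> : \prod_j mu (tau j) (overwrite tau S w (tau j)) = \prod_j mu (tau j) (S j).
  by apply: eq_bigr => j _; rewrite overwrite_in.
have -> : \prod_(i | i \notin codom tau) mu i (overwrite tau S w i) =
    \prod_(i | i \notin codom tau) mu i (w i).
  by apply: eq_bigr => i ni; rewrite overwrite_out.
have -> : \prod_j mu (tau j) ([ffun j0 => w (tau j0)] j) = \prod_j mu (tau j) (w (tau j)).
  by apply: eq_bigr => j _; rewrite ffunE.
by ring.
Qed.

(** After the coordinates in the image of [tau] are resampled, reading them back returns the fresh
    sample, so the outer expectation is that of a constant. *)
Lemma pexp_marginal (mu : I -> T -> R) (h : {ffun K -> T} -> R) :
  (forall i, prob (mu i)) ->
  pexp mu (fun w => h [ffun j => w (tau j)]) = pexp (fun j => mu (tau j)) h.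
Proof.
move=> muP; rewrite -pexp_overwrite //.
under eq_pexp => w do under eq_pexp => S do rewrite overwrite_comp.
by rewrite pexp_cst.
Qed.

End Overwrite.

End ProductExpectation.

(** * Sampling indices with and without replacement *)

Section IndexMaps.
Variable R : realType.

(** The birthday bound [1 - m ^_ n / m ^ n <= n ^ 2 / m], cleared of denominators and of truncated
    subtraction so that induction on [n] stays in the naturals. *)
Lemma expn_sub_ffact n m : (m ^ n * m <= m ^_ n * m + n ^ 2 * m ^ n)%N.
Proof.
elim: n => [|n IH]; first by rewrite expn0 ffactn0 leq_addr.
case: (leqP m n) => [mn|nm].
  apply: leq_trans (leq_addl _ _); rewrite mulnC leq_mul2r.
  by apply/orP; right; apply: leq_trans (leqW mn) _; rewrite expnS expn1 leq_pmulr.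
rewrite ffactnSr expnS.
have : (m ^ n * m * (m - n) <= (m ^_ n * m + n ^ 2 * m ^ n) * (m - n))%N.
  by rewrite leq_mul2r IH orbT.
have : (n ^ 2 * m ^ n * (m - n) <= n ^ 2 * m ^ n * m)%N.
  by rewrite leq_mul2l leq_subr orbT.
have : (m ^ n * m * m = m ^ n * m * (m - n) + m ^ n * m * n)%N.
  by rewrite -mulnDr subnK // ltnW.
move: (m ^_ n)%N (m ^ n)%N (m - n)%N => J M d.
rewrite -[n.+1]addn1 sqrnD => e1 e2 e3.
have : (M * m * n <= 2 * (M * m * n))%N by rewrite mul2n -addnn leq_addr.
rewrite !mulnDl in e3 *; nia.
Qed.

Lemma injsP n m (s : {ffun 'I_n -> 'I_m}) : reflect (injective s) (s \in injs n m).
Proof. by rewrite inE; exact: injectiveP. Qed.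

Lemma card_injs n m : #|injs n m| = (m ^_ n)%N.
Proof. by rewrite card_inj_ffuns !card_ord. Qed.


Lemma sum_noninjs_le n m (a : {ffun 'I_n -> 'I_m} -> R) : (0 < m)%N ->
  (forall s, a s <= 1) ->
  \sum_(s | s \notin injs n m) a s <= n%:R ^+ 2 / m%:R * (m ^ n)%:R.
Proof.
move=> m0 a1; apply: (@le_trans _ _ ((m ^ n)%:R - (m ^_ n)%:R)).
  rewrite lerBrDr; have -> : (m ^_ n)%:R = \sum_(s in injs n m) (1 : R).
    by rewrite sumr_const card_injs.
  have -> : (m ^ n)%:R = \sum_(s : {ffun 'I_n -> 'I_m}) (1 : R).
    by rewrite sumr_const card_ffun !card_ord.
  rewrite [leRHS](bigID (mem (injs n m))) /= [leLHS]addrC.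
  by apply: lerD => //; apply: ler_sum => s _.
have m0' : (0 : R) < m%:R by rewrite ltr0n.
rewrite lerBlDr mulrAC -(ler_pM2r m0') mulrDl divfK ?gt_eqF //.
have := expn_sub_ffact n m.
by rewrite -(ler_nat R) natrD !natrM !natrX addrC.
Qed.

(** Injective terms cancel; each remaining term differs by at most 1, and the birthday bound limits
    their share. *)
Lemma index_avg_agree n m (a b : {ffun 'I_n -> 'I_m} -> R) : (0 < m)%N ->
  (forall s, 0 <= a s <= 1) -> (forall s, 0 <= b s <= 1) ->
  (forall s : {ffun _ -> _}, injective s -> a s = b s) ->
  `|(m ^ n)%:R^-1 * (\sum_s a s) - (m ^ n)%:R^-1 * (\sum_s b s)|
    <= n%:R ^+ 2 / m%:R.
Proof.
move=> m0 a01 b01 ab.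
have M0 : (0 : R) < (m ^ n)%:R by rewrite ltr0n expn_gt0 m0.
rewrite -mulrBr normrM ger0_norm ?invr_ge0 ?ler0n // ler_pdivrMl // mulrC.
rewrite -sumrB (bigID (mem (injs n m))) /= big1 ?add0r; last first.
  by move=> s /injsP /ab ->; rewrite subrr.
apply: le_trans (ler_norm_sum _ _ _) _; apply: sum_noninjs_le => // s.
by have := a01 s; have := b01 s; rewrite ler_norml; lra.
Qed.

Lemma index_avg_injs n m (a : {ffun 'I_n -> 'I_m} -> R) :
  (0 < m)%N -> (n <= m)%N -> (forall s, 0 <= a s <= 1) ->
  `|(m ^ n)%:R^-1 * (\sum_s a s) - #|injs n m|%:R^-1 * (\sum_(s in injs n m) a s)|
    <= n%:R ^+ 2 / m%:R.
Proof.
move=> m0 nm a01.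
have M0 : (0 : R) < (m ^ n)%:R by rewrite ltr0n expn_gt0 m0.
have J0 : (0 : R) < #|injs n m|%:R by rewrite ltr0n card_injs ffact_gt0.
pose c := #|injs n m|%:R^-1 * \sum_(s in injs n m) a s.
have sum_bounds : 0 <= \sum_(s in injs n m) a s <= #|injs n m|%:R.
  rewrite sumr_ge0 => [|s _]; last by case/andP: (a01 s).
  rewrite -sumr_const; apply: ler_sum => s _; by case/andP: (a01 s).
have c01 : 0 <= c <= 1.
  case/andP: sum_bounds => h0 h1.
  by rewrite mulr_ge0 ?invr_ge0 ?ler0n //= ler_pdivrMl // mulr1.
(* The mean [c] over injective maps is spread over all maps. The injective part of the difference
   then vanishes exactly, which leaves the non-injective terms. *)
have -> : #|injs n m|%:R^-1 * \sum_(s in injs n m) a s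
    = (m ^ n)%:R^-1 * \sum_(s : {ffun 'I_n -> 'I_m}) c.
  by rewrite sumr_const card_ffun !card_ord -[c *+ _]mulr_natl mulKf ?gt_eqF.
rewrite -mulrBr normrM ger0_norm ?invr_ge0 ?ler0n // ler_pdivrMl // mulrC.
rewrite -sumrB (bigID (mem (injs n m))) /= sumrB sumr_const.
rewrite -[c *+ _]mulr_natl {1}/c mulVKf ?gt_eqF // subrr add0r.
apply: le_trans (ler_norm_sum _ _ _) _; apply: sum_noninjs_le => // s.
by have := a01 s; rewrite ler_norml; lra.
Qed.

End IndexMaps.

(** * Mixtures of independent random laws *)

Section Averages.
Variables (R : realType) (X : finType).

Definition avg m (P : 'I_m -> X -> R) : X -> R := fun x => m%:R^-1 * \sum_i P i x.

Lemma prob_avg m (P : 'I_m -> X -> R) :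
  (0 < m)%N -> (forall i, prob (P i)) -> prob (avg P).
Proof.
move=> m0 PP; split=> [x|].
  by rewrite mulr_ge0 ?invr_ge0 ?ler0n ?sumr_ge0 // => i _; case: (PP i).
rewrite -mulr_sumr exchange_big (eq_bigr (fun=> 1)) => [|i _]; last by case: (PP i).
by rewrite sumr_const card_ord mulVf // pnatr_eq0 -lt0n.
Qed.

(** Expanding the product of averages: [n] draws from the mixture amount to a uniform index map [s],
    repetitions allowed, followed by draws from the laws [P (s i)]. *)
Lemma pexp_avg n m (P : 'I_m -> X -> R) (h : {ffun 'I_n -> X} -> R) :
  pexp (fun _ => avg P) h =
  (m ^ n)%:R^-1 * \sum_(s : {ffun 'I_n -> 'I_m}) pexp (fun i => P (s i)) h.
Proof.
rewrite /pexp exchange_big mulr_sumr; apply: eq_bigr => y _.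
rewrite -mulr_suml mulrA; congr (_ * _).
rewrite /avg big_split /= prodr_const card_ord natrX -exprVn; congr (_ * _).
by rewrite (bigA_distr_bigA (fun i j => P j (y i))).
Qed.

Lemma pexp_comp (I T : finType) (mu : I -> T -> R) (K : I -> T -> X -> R) h :
  pexp mu (fun w => pexp (fun i => K i (w i)) h)
  = pexp (fun i x => \sum_a mu i a * K i a x) h.
Proof.
rewrite /pexp; under eq_bigr do rewrite mulr_sumr.
rewrite exchange_big; apply: eq_bigr => y _ /=.
rewrite (bigA_distr_bigA (fun i a => mu i a * K i a (y i))) mulr_suml.
by apply: eq_bigr => w _; rewrite mulrA -big_split.
Qed.

Lemma pexp_unit_itv (I T : finType) (mu : I -> T -> R) h :
  (forall i, prob (mu i)) -> (forall w, 0 <= h w <= 1) -> 0 <= pexp mu h <= 1.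
Proof.
move=> muP h01; rewrite pexp_ge0 ?pexp_le // => w; by case/andP: (h01 w).
Qed.

Lemma prob_mix (T : finType) (p : T -> R) (K : T -> X -> R) :
  prob p -> (forall a, prob (K a)) -> prob (fun x => \sum_a p a * K a x).
Proof.
move=> [p0 p1] KP; split=> [x|].
  by apply: sumr_ge0 => a _; rewrite mulr_ge0 //; case: (KP a).
rewrite exchange_big -p1; apply: eq_bigr => a _.
by rewrite -mulr_sumr; case: (KP a) => _ ->; rewrite mulr1.
Qed.

(* The error comes from the index maps that hit some coordinate of [w] twice. *)
Lemma pexp_avg_mean n m (T : finType) (mu : 'I_m -> T -> R)
    (K : 'I_m -> T -> X -> R) (h : {ffun 'I_n -> X} -> R) :
  (0 < m)%N -> (forall i, prob (mu i)) -> (forall i a, prob (K i a)) ->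
  (forall y, 0 <= h y <= 1) ->
  `|pexp mu (fun w => pexp (fun=> avg (fun i => K i (w i))) h)
    - pexp (fun=> avg (fun i x => \sum_a mu i a * K i a x)) h|
    <= n%:R ^+ 2 / m%:R.
Proof.
move=> m0 muP KP h01.
under eq_pexp => w do rewrite pexp_avg.
rewrite pexpZ pexp_sum pexp_avg; apply: index_avg_agree => // [s|s|s s_inj].
- by apply: pexp_unit_itv => // w; apply: pexp_unit_itv.
- by apply: pexp_unit_itv => // i; exact: prob_mix.
(* For injective [s] the coordinates [w (s i)] are independent, so averaging over [w] replaces each
   kernel by its mean. *)
rewrite -(pexp_comp (fun i => mu (s i)) (fun i => K (s i))).
rewrite -(pexp_marginal s_inj) //.
by apply: eq_pexp => w; apply: eq_pexp_mu => i x; rewrite ffunE.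
Qed.

End Averages.

(** * Lipschitz dependence of expectations on the laws *)

Section Lipschitz.
Variables (R : realType) (I T : finType).

Lemma pexp_lip1 (mu nu : I -> T -> R) h j :
  (forall i, prob (mu i)) -> (forall w, 0 <= h w <= 1) ->
  (forall i, i != j -> nu i = mu i) ->
  `|pexp mu h - pexp nu h| <= \sum_x `|mu j x - nu j x|.
Proof.
move=> muP h01 e.
(* With the difference as the factor at [j], the bound becomes a product of sums in which every
   other coordinate contributes 1. *)
pose c i x := if i == j then `|mu j x - nu j x| else mu i x.
have -> : \sum_x `|mu j x - nu j x| = \prod_i \sum_x c i x.
  rewrite (bigD1 j) //= /c eqxx [X in _ * X]big1 ?mulr1 // => i /negbTE ->.
  by case: (muP i).
rewrite bigA_distr_bigA /pexp -sumrB; apply: le_trans (ler_norm_sum _ _ _) _.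
apply: ler_sum => w _; rewrite -mulrBl normrM.
apply: (@le_trans _ _ `|\prod_i mu i (w i) - \prod_i nu i (w i)|).
  by rewrite ler_piMr // ler_norml; have := h01 w; lra.
rewrite (bigD1 j) //= (bigD1 j (P := xpredT) (F := fun i => nu i (w i))) //=.
have -> : \prod_(i | i != j) nu i (w i) = \prod_(i | i != j) mu i (w i).
  by apply: eq_bigr => i /e ->.
rewrite -mulrBl normrM [leRHS](bigD1 j) //= /c eqxx.
rewrite [X in _ * X]ger0_norm; last by apply: prodr_ge0 => i _; case: (muP i).
rewrite ler_wpM2l // le_eqVlt; apply/orP; left; apply/eqP.
by apply: eq_bigr => i /negbTE ->.
Qed.

(** Hybrid argument: the laws are exchanged one coordinate at a time, each at the cost given by
    [pexp_lip1]. *)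
Lemma pexp_lip (mu nu : I -> T -> R) h :
  (forall i, prob (mu i)) -> (forall i, prob (nu i)) -> (forall w, 0 <= h w <= 1) ->
  `|pexp mu h - pexp nu h| <= \sum_i \sum_x `|mu i x - nu i x|.
Proof.
move=> muP nuP h01.
pose mix (s : seq I) i := if i \in s then nu i else mu i.
have mixP s i : prob (mix s i) by rewrite /mix; case: ifP.
have H s : uniq s ->
    `|pexp mu h - pexp (mix s) h| <= \sum_(i <- s) \sum_x `|mu i x - nu i x|.
  elim: s => [_|j s IH /andP[js us]].
    by rewrite (@eq_pexp_mu _ _ _ (mix [::]) mu) // subrr normr0 big_nil.
  rewrite big_cons [leRHS]addrC; apply: le_trans (ler_distD (pexp (mix s) h) _ _) _.
  apply: lerD; first exact: IH.
  apply: le_trans (@pexp_lip1 _ _ _ j _ h01 _) _ => // [i ij|].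
    by rewrite /mix in_cons (negbTE ij).
  by rewrite /mix (negbTE js) in_cons eqxx.
have := H (index_enum I) (index_enum_uniq I).
rewrite (@eq_pexp_mu _ _ _ (mix _) nu) // => i x; by rewrite /mix mem_index_enum.
Qed.

End Lipschitz.

Lemma pexp_lip_iid (R : realType) (T : finType) n (p q : T -> R) (h : {ffun 'I_n -> T} -> R) :
  prob p -> prob q -> (forall w, 0 <= h w <= 1) ->
  `|pexp (fun=> p) h - pexp (fun=> q) h| <= n%:R * \sum_x `|p x - q x|.
Proof.
move=> pP qP h01; apply: le_trans (pexp_lip _ _ h01) _ => //.
by rewrite sumr_const card_ord mulr_natl.
Qed.

(** * Exponential moments and a maximal inequality under bounded differences *)

Section BoundedDifferences.
Variable R : realType.

(** From [1 - x <= expR (- x)], together with [(1 - x) * (1 + x + 2 * x ^+ 2) = 1 + x ^+ 2 * (1 - 2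
    * x)]. *)
Lemma expR_le_quadratic (x : R) : `|x| <= 2^-1 -> expR x <= 1 + x + 2 * x ^+ 2.
Proof.
rewrite ler_norml => /andP[x1 x2].
have h : 0 < 1 - x by lra.
have -> : expR x = (expR (- x))^-1 by rewrite expRN invrK.
apply: (@le_trans _ _ (1 - x)^-1).
  by rewrite lef_pV2 ?posrE ?expR_gt0 // expR_ge1Dx.
rewrite -[leLHS]mul1r ler_pdivrMr //.
have : 0 <= x ^+ 2 * (1 - 2 * x) by rewrite mulr_ge0 ?sqr_ge0 //; lra.
by rewrite !expr2; nra.
Qed.

(** A Hoeffding-type bound with a crude constant: [v] stays within [c] of its mean, and in the
    quadratic bound on the exponential the linear term averages to zero. *)
Lemma mgf_one (T : finType) (p v : T -> R) (c lam : R) :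
  prob p -> (forall a b, v a <= v b + c) -> 0 <= lam -> lam * c <= 2^-1 ->
  \sum_a p a * expR (lam * v a) <=
  expR (lam * (\sum_a p a * v a) + 2 * (lam * c) ^+ 2).
Proof.
move=> [p0 p1] vc l0 lc; set e := \sum_a p a * v a.
have dev a : `|v a - e| <= c.
  have -> : v a - e = \sum_b p b * (v a - v b).
    rewrite /e; under [RHS]eq_bigr do rewrite mulrBr.
    by rewrite sumrB -mulr_suml p1 mul1r.
  apply: le_trans (ler_norm_sum _ _ _) _.
  rewrite -[leRHS]mul1r -p1 mulr_suml; apply: ler_sum => b _.
  rewrite normrM ger0_norm // ler_wpM2l // ler_norml.
  by have := vc a b; have := vc b a; lra.
have dev2 a : `|lam * (v a - e)| <= lam * c by rewrite normrM ger0_norm // ler_wpM2l.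
rewrite expRD.
apply: (@le_trans _ _ (expR (lam * e) * (1 + 2 * (lam * c) ^+ 2))); last first.
  by rewrite ler_wpM2l ?expR_ge0 // expR_ge1Dx.
have -> : expR (lam * e) * (1 + 2 * (lam * c) ^+ 2)
    = \sum_a p a * (expR (lam * e) * (1 + lam * (v a - e) + 2 * (lam * c) ^+ 2)).
  under eq_bigr do rewrite mulrCA.
  rewrite -mulr_sumr; congr (_ * _).
  under eq_bigr do rewrite !mulrDr mulr1 [_ * (lam * - e)]mulrCA [_ * (lam * v _)]mulrCA.
  rewrite !big_split /= -!mulr_sumr -/e p1 -!mulr_suml p1; ring.
apply: ler_sum => a _; rewrite ler_wpM2l //.
have -> : lam * v a = lam * e + lam * (v a - e) by ring.
rewrite expRD ler_wpM2l ?expR_ge0 //.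
apply: le_trans (expR_le_quadratic (le_trans (dev2 a) lc)) _.
rewrite lerD2l ler_pM2l // -real_normK ?num_real //.
by rewrite lerXn2r ?nnegrE // (le_trans _ (dev2 a)).
Qed.

Section Product.
Variables (I T : finType) (mu : I -> T -> R).
Hypothesis muP : forall i, prob (mu i).

Definition upd (w : {ffun I -> T}) j a : {ffun I -> T} :=
  [ffun i => if i == j then a else w i].

(** The conditional expectation of [G] given all coordinates except [j]. *)
Definition meanv j (G : {ffun I -> T} -> R) w := \sum_a mu j a * G (upd w j a).

Lemma upd_upd w j a b : upd (upd w j a) j b = upd w j b.
Proof. by apply/ffunP => i; rewrite !ffunE; case: eqP. Qed.

Lemma updC w i j a b : i != j -> upd (upd w i a) j b = upd (upd w j b) i a.
Proof.
move=> ij; apply/ffunP => k; rewrite !ffunE; case: eqP => [->|//].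
by rewrite eq_sym (negbTE ij).
Qed.

(** The tower property, obtained from [pexp_overwrite] with a one-point index type. *)
Lemma pexp_meanv j G : pexp mu (meanv j G) = pexp mu G.
Proof.
have tau_inj : injective (fun _ : unit => j).
  by move=> x y _; case: x; case: y.
rewrite -(pexp_overwrite tau_inj G muP); apply: eq_pexp => w.
rewrite /meanv /pexp (reindex (fun a => [ffun _ : unit => a])) /=; last first.
  exists (fun S : {ffun unit -> T} => S tt) => [a _|S _]; first by rewrite ffunE.
  by apply/ffunP => -[]; rewrite ffunE.
apply: eq_bigr => a _; congr (_ * G _).
  by rewrite (big_pred1 tt) ?ffunE // => -[].
apply/ffunP => i; have [->|ij] := eqVneq i j.
  by rewrite (overwrite_in tau_inj _ _ tt) !ffunE eqxx.
rewrite overwrite_out ?ffunE ?(negbTE ij) //.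
by apply/codomP => -[_ e]; rewrite e eqxx in ij.
Qed.

Definition bdiff (c : R) (G : {ffun I -> T} -> R) :=
  forall w j a b, G (upd w j a) <= G (upd w j b) + c.

Lemma bdiff_meanv c G j : 0 <= c -> bdiff c G -> bdiff c (meanv j G).
Proof.
move=> c0 Gc w i a b; rewrite /meanv.
have [->|ij] := eqVneq i j.
  under eq_bigr do rewrite upd_upd.
  by under [X in _ <= X + _]eq_bigr do rewrite upd_upd; rewrite lerDl.
have -> : c = \sum_x mu j x * c by rewrite -mulr_suml; case: (muP j) => _ ->; rewrite mul1r.
rewrite -big_split /=; apply: ler_sum => x _; rewrite -mulrDr ler_wpM2l //.
  by case: (muP j).
by rewrite ![upd (upd _ i _) _ _]updC.
Qed.

(** The predicate [A] records the coordinates already integrated out, which is the generalisation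
    that the induction on [s] needs. *)
Lemma foldl_meanv_indep (s : seq I) (A : pred I) (G : {ffun I -> T} -> R) :
  (forall w w' : {ffun I -> T}, (forall i, ~~ A i -> w i = w' i) -> G w = G w') ->
  forall w w' : {ffun I -> T}, (forall i, ~~ A i -> i \notin s -> w i = w' i) ->
  foldl (fun G j => meanv j G) G s w = foldl (fun G j => meanv j G) G s w'.
Proof.
elim: s A G => [|j s IH] A G GA w w' ww' /=; first by apply: GA => i /ww'; apply.
apply: (IH (predU1 j A)) => [v v' vv'|i].
  apply: eq_bigr => a _; congr (_ * _); apply: GA => i iA; rewrite !ffunE.
  by case: eqVneq => // ij; apply: vv'; rewrite /= negb_or ij.
rewrite /= negb_or => /andP[ij iA] si.
by apply: ww' => //; rewrite in_cons negb_or ij.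
Qed.

(** McDiarmid's argument: integrating out one coordinate costs a factor [expR (2 * (lam * c) ^+ 2)]
    and keeps the bounded differences; after all coordinates only the constant [pexp mu G] is
    left. *)
Lemma mgf_bdiff (c lam : R) G : 0 <= c -> 0 <= lam -> lam * c <= 2^-1 -> bdiff c G ->
  pexp mu (fun w => expR (lam * G w)) <=
  expR (lam * pexp mu G + 2 * (lam * c) ^+ 2 * #|I|%:R).
Proof.
move=> c0 l0 lc Gc.
have H s : forall G, bdiff c G -> pexp mu (fun w => expR (lam * G w)) <=
    expR (2 * (lam * c) ^+ 2 * (size s)%:R) *
    pexp mu (fun w => expR (lam * foldl (fun G j => meanv j G) G s w)).
  elim: s => [|j s IH] {Gc}G Gc; first by rewrite mulr0 expR0 mul1r.
  rewrite /= -[leLHS](pexp_meanv j).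
  have step : pexp mu (meanv j (fun w => expR (lam * G w))) <=
      pexp mu (fun w => expR (2 * (lam * c) ^+ 2) * expR (lam * meanv j G w)).
    apply: ler_pexp => // w; rewrite mulrC -expRD.
    by apply: mgf_one => // a b; exact: Gc.
  apply: le_trans step _; rewrite pexpZ -[(size s).+1%:R]natr1 mulrDr mulr1 [_ * (size s)%:R + _]addrC expRD -mulrA.
  by rewrite ler_wpM2l ?expR_ge0 // IH //; exact: bdiff_meanv.
apply: le_trans (H (enum I) G Gc) _.
set L := foldl _ G (enum I).
have Lmean : pexp mu L = pexp mu G.
  rewrite /L; elim: (enum I) G {Gc L H} => //= j s IH G.
  by rewrite IH pexp_meanv.
have Lcst w w' : L w = L w'.
  apply: (foldl_meanv_indep (A := pred0)) => [v v' e|i _]; last by rewrite mem_enum.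
  by congr G; apply/ffunP => i; exact: e.
rewrite expRD mulrC -cardE ler_wpM2r ?expR_ge0 //.
apply: pexp_le => // w; rewrite -Lmean (_ : pexp mu L = L w) //.
by rewrite -[RHS](pexp_cst muP); apply: eq_pexp => w'; exact: Lcst.
Qed.

(* Exponential moments turn the union bound over [U] into the additive term
   [ln #|U| / lam]. *)
Lemma pexp_softmax (U : finType) (G : U -> {ffun I -> T} -> R) g (c lam B : R) :
  (0 < #|U|)%N -> 0 <= c -> 0 < lam -> lam * c <= 2^-1 ->
  (forall u, bdiff c (G u)) -> (forall u, pexp mu (G u) <= B) ->
  (forall w, exists u, g w <= G u w) ->
  pexp mu g <= B + ln #|U|%:R / lam + 2 * lam * c ^+ 2 * #|I|%:R.
Proof.
move=> U0 c0 l0 lc Gc GB gG.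
have U0' : (0 : R) < #|U|%:R by rewrite ltr0n.
(* This [q] makes the expected sum of [expR (lam * G u w - q)] at most 1; the inequality
   [1 + x <= expR x] then does the work of Jensen's inequality. *)
pose q := lam * B + ln #|U|%:R + 2 * (lam * c) ^+ 2 * #|I|%:R.
have : pexp mu (fun w => 1 + (lam * g w - q)) <= 1.
  apply: (@le_trans _ _ (pexp mu (fun w => \sum_u expR (- q) * expR (lam * G u w)))).
    apply: ler_pexp => // w; apply: le_trans (expR_ge1Dx _) _.
    have [u gu] := gG w; rewrite (bigD1 u) //= [lam * _ - q]addrC expRD ler_wpDr //.
      by apply: sumr_ge0 => v _; rewrite mulr_ge0 ?expR_ge0.
    by rewrite ler_wpM2l ?expR_ge0 // ler_expR ler_wpM2l // ltW.
  rewrite pexp_sum.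
  apply: (@le_trans _ _ (\sum_(u : U) expR (- q) *
      expR (lam * B + 2 * (lam * c) ^+ 2 * #|I|%:R))).
    apply: ler_sum => u _; rewrite pexpZ ler_wpM2l ?expR_ge0 //.
    apply: le_trans (mgf_bdiff c0 (ltW l0) lc (Gc u)) _.
    by rewrite ler_expR lerD2r ler_wpM2l // ltW.
  rewrite sumr_const -expRD -[_ *+ #|U|]mulr_natl -[X in X * expR _]lnK ?posrE // -expRD /q.
  by rewrite [X in expR X](_ : _ = 0) ?expR0 //; ring.
rewrite !pexpD pexpZ !pexp_cst // gerDl subr_le0 /q => h.
rewrite -(ler_pM2l l0); apply: le_trans h _.
rewrite le_eqVlt; apply/orP; left; apply/eqP; field.
by rewrite gt_eqF.
Qed.

End Product.
End BoundedDifferences.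

Lemma mean_cst (R : realType) m (c : R) : (0 < m)%N ->
  m%:R^-1 * (\sum_(i < m) c) = c.
Proof.
by move=> m0; rewrite sumr_const card_ord -[c *+ m]mulr_natl mulKf // pnatr_eq0 -lt0n.
Qed.

(** * Corruption laws that depend on the clean points *)

Section AdaptiveUpperBound.
Variables (R : realType) (X T : finType) (m : nat).

Lemma dist_prob_le2 (p q : X -> R) : prob p -> prob q -> \sum_x `|p x - q x| <= 2.
Proof.
move=> [p0 p1] [q0 q1]; have -> : 2 = \sum_x (p x + q x) by rewrite big_split /= p1 q1.
apply: ler_sum => x _; apply: le_trans (ler_normB _ _) _.
by rewrite !ger0_norm.
Qed.

Lemma avg_dist1 (P Q : 'I_m -> X -> R) j :
  (forall i, prob (P i)) -> (forall i, prob (Q i)) -> (forall i, i != j -> P i = Q i) ->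
  \sum_x `|avg P x - avg Q x| <= 2 / m%:R.
Proof.
move=> PP QP e; rewrite (eq_bigr (fun x => m%:R^-1 * `|P j x - Q j x|)) => [|x _].
  by rewrite -mulr_sumr mulrC ler_wpM2r ?invr_ge0 ?ler0n // dist_prob_le2.
rewrite /avg -mulrBr -sumrB (bigD1 j) //= big1 ?addr0.
  by rewrite normrM ger0_norm ?invr_ge0 ?ler0n.
by move=> i /e ->; rewrite subrr.
Qed.

(* [c i a = None] means that position [i] is corrupted; it is then given the law [W]. *)
Definition complete (c : 'I_m -> T -> option X) (W : X -> R) i a : X -> R :=
  if c i a is Some y then fun x => (y == x)%:R else W.

Variable c : 'I_m -> T -> option X.

Lemma prob_complete W i a : prob W -> prob (complete c W i a).
Proof. by rewrite /complete; case: (c i a) => [y|] // _; exact: prob_delta. Qed.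

(** Completion is affine in the corruption law; at the revealed positions this uses that [p] has
    total mass 1. *)
Lemma complete_mix (Z : finType) (p : Z -> R) (K : Z -> X -> R) i a x :
  prob p -> \sum_z p z * complete c (K z) i a x
  = complete c (fun x => \sum_z p z * K z x) i a x.
Proof.
by move=> [_ p1]; rewrite /complete; case: (c i a) => // y; rewrite -mulr_suml p1 mul1r.
Qed.

Definition unif t (u : {ffun 'I_t -> X}) : X -> R := avg (fun l x => (u l == x)%:R).

Lemma prob_unif t (u : {ffun 'I_t -> X}) : (0 < t)%N -> prob (unif u).
Proof. by move=> t0; apply: prob_avg => // i; exact: prob_delta. Qed.

(** Probabilistic method: [W] is the mean of the point masses at [t] independent draws from it, so
    [pexp_avg_mean] bounds the loss on average over the draws, and some outcome [u] is at least as
    good as the average. *)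
Lemma complete_discretize n t (h : {ffun 'I_n -> X} -> R) W (w : {ffun 'I_m -> T}) :
  (0 < m)%N -> (0 < t)%N -> (0 < #|X|)%N -> (forall y, 0 <= h y <= 1) -> prob W ->
  exists u : {ffun 'I_t -> X},
    pexp (fun=> avg (fun i => complete c W i (w i))) h <=
    pexp (fun=> avg (fun i => complete c (unif u) i (w i))) h + n%:R ^+ 2 / t%:R.
Proof.
move=> m0 t0 X0 h01 WP.
pose K (l : 'I_t) y := avg (fun i => complete c (fun x => (y == x)%:R) i (w i)).
have KP l y : prob (K l y).
  by apply: prob_avg => // i; apply: prob_complete; exact: prob_delta.
have := pexp_avg_mean t0 (fun=> WP) KP h01.
have -> : pexp (fun=> avg (fun i x => \sum_a W a * K i a x)) h
    = pexp (fun=> avg (fun i => complete c W i (w i))) h.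
  apply: eq_pexp_mu => _ x; rewrite {1}/avg.
  have E (l : 'I_t) : \sum_a W a * K l a x = avg (fun i => complete c W i (w i)) x.
    rewrite /K /avg; under eq_bigr do rewrite mulrCA mulr_sumr.
    rewrite -mulr_sumr exchange_big; congr (_ * _); apply: eq_bigr => i _.
    rewrite complete_mix //=; rewrite /complete; case: (c i (w i)) => //.
    rewrite (bigD1 x) //= eqxx mulr1 big1 ?addr0 // => y /negbTE ->.
    by rewrite mulr0.
  under eq_bigr do rewrite E.
  by rewrite mean_cst.
have [u hu] := pexp_exists (fun=> WP)
  (fun u => pexp (fun=> avg (fun l => K l (u l))) h) [ffun=> enum_val (Ordinal X0)].
rewrite ler_norml => /andP[H _]; exists u; rewrite -lerBlDr.
apply: le_trans (_ : _ <= pexp (fun=> avg (fun l => K l (u l))) h) _.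
  by apply: le_trans hu; lra.
rewrite le_eqVlt; apply/orP; left; apply/eqP; apply: eq_pexp_mu => _ x.
rewrite /avg /K /avg -mulr_sumr mulrCA exchange_big mulr_sumr; congr (_ * _).
apply: eq_bigr => i _.
have pP : prob (fun _ : 'I_t => t%:R^-1 : R).
  split=> [_|]; first by rewrite invr_ge0 ler0n.
  by rewrite -[RHS](mean_cst 1 t0) mulr_sumr; under [RHS]eq_bigr do rewrite mulr1.
rewrite mulr_sumr (complete_mix (fun l x => (u l == x)%:R) _ _ _ pP).
by rewrite /complete; case: (c _ _) => //; rewrite /unif /avg mulr_sumr.
Qed.

(** Decoupling: in the bound on [g] the law [W] may depend on [w], whereas [B] only controls laws
    fixed in advance. Discretization leaves finitely many candidates, to which [pexp_softmax]
    applies. *)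
Lemma pexp_complete_le n t (mu : 'I_m -> T -> R) (h : {ffun 'I_n -> X} -> R) g
    (lam B : R) :
  (0 < m)%N -> (0 < t)%N -> (0 < #|X|)%N -> 0 < lam ->
  lam * (2 * n%:R / m%:R) <= 2^-1 ->
  (forall i, prob (mu i)) -> (forall y, 0 <= h y <= 1) ->
  (forall w : {ffun 'I_m -> T}, exists2 W, prob W &
     g w <= pexp (fun=> avg (fun i => complete c W i (w i))) h) ->
  (forall W, prob W ->
     pexp (fun=> avg (fun i x => \sum_a mu i a * complete c W i a x)) h <= B) ->
  pexp mu g <= B + n%:R ^+ 2 / m%:R + n%:R ^+ 2 / t%:R + t%:R * ln #|X|%:R / lam
               + 2 * lam * (2 * n%:R / m%:R) ^+ 2 * m%:R.
Proof.
move=> m0 t0 X0 l0 lc muP h01 gW WB.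
have -> : t%:R * ln #|X|%:R = ln #|{ffun 'I_t -> X}|%:R :> R.
  by rewrite card_ffun card_ord natrX lnXn ?ltr0n // mulr_natl.
pose G (u : {ffun 'I_t -> X}) (w : {ffun 'I_m -> T}) :=
  pexp (fun=> avg (fun i => complete c (unif u) i (w i))) h + n%:R ^+ 2 / t%:R.
have := @pexp_softmax _ _ _ _ muP _ G g (2 * n%:R / m%:R) lam
  (B + n%:R ^+ 2 / m%:R + n%:R ^+ 2 / t%:R).
rewrite (card_ord m); apply => //.
- by rewrite card_ffun expn_gt0 X0.
(* Changing one coordinate moves the averaged law by [2 / m] in total, and the value depends on [n]
   draws from that law. *)
- move=> u w j a b; rewrite /G addrAC lerD2r.
  set p := avg _; set q := avg _.
  have pP : prob p by apply: prob_avg => // i; apply: prob_complete; exact: prob_unif.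
  have qP : prob q by apply: prob_avg => // i; apply: prob_complete; exact: prob_unif.
  have := pexp_lip_iid pP qP h01; rewrite ler_norml => /andP[_].
  rewrite lerBlDl => H; apply: le_trans H _; rewrite lerD2l.
  rewrite -mulrA mulrCA ler_wpM2l ?ler0n //; apply: (@avg_dist1 _ _ j) => [i|i|i ij].
  + by apply: prob_complete; exact: prob_unif.
  + by apply: prob_complete; exact: prob_unif.
  + by rewrite !ffunE (negbTE ij).
(* For a fixed candidate the random mixture may be replaced by its mean, to which the hypothesis on
   [B] applies. *)
- move=> u; rewrite /G pexpD pexp_cst // lerD2r.
  have uP := prob_unif u t0.
  have := pexp_avg_mean m0 muP (fun i a => prob_complete i a uP) h01.
  rewrite ler_norml => /andP[_]; rewrite lerBlDl => H; apply: le_trans H _.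
  by rewrite lerD2r WB.
- move=> w; have [W WP gw] := gW w.
  have [u hu] := complete_discretize w m0 t0 X0 h01 WP.
  by exists u; apply: le_trans gw hu.
Qed.

End AdaptiveUpperBound.

(** * Sequential strategies and malicious noise *)

Section SequentialSampling.
Variables (R : realType) (X : finType) (m : nat).
Hypothesis X0 : (0 < #|X|)%N.

Definition adapted (K : 'I_m -> {ffun 'I_m -> X} -> X -> R) : Prop :=
  forall (i : 'I_m) (h h' : {ffun 'I_m -> X}), (forall j : 'I_m, (j < i)%N -> h j = h' j) -> K i h =1 K i h'.

(** Uniform weights turn a plain sum into a product expectation, so that [pexp_meanv] can average a
    single coordinate. *)
Lemma sum_ffun_pexp (F : {ffun 'I_m -> X} -> R) :
  \sum_x F x = #|X|%:R ^+ m * pexp (fun _ _ => #|X|%:R^-1) F.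
Proof.
rewrite /pexp prodr_const card_ord -mulr_sumr exprVn mulVKf //.
by rewrite expf_neq0 // pnatr_eq0 -lt0n.
Qed.

(* The factors are replaced one by one, starting from the last, by the uniform
   weight, which leaves the sum unchanged. *)
Lemma adapted_sum1 (K : 'I_m -> {ffun 'I_m -> X} -> X -> R) :
  adapted K -> (forall i h, \sum_a K i h a = 1) ->
  \sum_(x : {ffun 'I_m -> X}) \prod_i K i x (x i) = 1.
Proof.
move=> Kad K1; pose U : R := #|X|%:R^-1.
have XN : #|X|%:R != 0 :> R by rewrite pnatr_eq0 -lt0n.
have UP (i : 'I_m) : prob (fun _ : X => U).
  split=> [_|]; first by rewrite invr_ge0 ler0n.
  by rewrite sumr_const -[_ *+ #|X|]mulr_natl mulfV.
pose hyb j := \sum_(x : {ffun 'I_m -> X}) \prod_(i < m)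
  (if (i < j)%N then K i x (x i) else U).
have -> : \sum_(x : {ffun 'I_m -> X}) \prod_i K i x (x i) = hyb m.
  by apply: eq_bigr => x _; apply: eq_bigr => i _; rewrite ltn_ord.
have hybS j : (j < m)%N -> hyb j.+1 = hyb j.
  move=> jm; pose j' := Ordinal jm.
  (* By adaptedness the factors before [j] do not see coordinate [j], and the later ones are
     constant; [H] therefore factors out when that coordinate is averaged. *)
  pose H (x : {ffun 'I_m -> X}) := \prod_(i < m | i != j')
    (if (i < j)%N then K i x (x i) else U).
  have Hupd x a : H (upd x j' a) = H x.
    apply: eq_bigr => i ij; case: ifP => // ltij.
    rewrite [in LHS]ffunE (negbTE ij); apply: Kad => l li.
    by rewrite ffunE; case: eqP => // e; move: li; rewrite e /= ltnNge ltnW.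
  have hybj x : \prod_(i < m) (if (i < j)%N then K i x (x i) else U) = H x * U.
    by rewrite (bigD1 j') //= ltnn mulrC.
  have hybj1 x : \prod_(i < m) (if (i < j.+1)%N then K i x (x i) else U)
      = H x * K j' x (x j').
    rewrite (bigD1 j') //= ltnSn mulrC; congr (_ * _).
    apply: eq_bigr => i ij; rewrite ltnS leq_eqVlt.
    by rewrite (_ : (i : nat) == j = false) //; apply/eqP => e; case/eqP: ij; apply/val_inj.
  rewrite /hyb (eq_bigr _ (fun x _ => hybj x)) (eq_bigr _ (fun x _ => hybj1 x)).
  rewrite !sum_ffun_pexp; congr (_ * _).
  rewrite -(pexp_meanv UP j'); apply: eq_pexp => x.
  rewrite /meanv -mulr_sumr mulrC; congr (_ * _).
  rewrite -[RHS]mulr1 -(K1 j' x) mulr_sumr; apply: eq_bigr => a _.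
  rewrite Hupd [X in K _ _ X]ffunE eqxx; congr (_ * _); apply: Kad => l li.
  by rewrite ffunE; case: eqP => // e; move: li; rewrite e ltnn.
have -> : hyb m = hyb 0.
  suff : forall j, (j <= m)%N -> hyb j = hyb 0 by apply.
  by elim=> // j IH jm; rewrite hybS // IH // ltnW.
by have := weight_sum1 (fun i => UP i).
Qed.

Lemma sum_option (F : option X -> R) : \sum_a F a = F None + \sum_y F (Some y).
Proof.
rewrite (bigD1 None) //= (reindex_omap Some id) /=; last by case.
by congr (_ + _); apply: eq_bigl => y; rewrite eqxx.
Qed.

Definition fill (w : {ffun 'I_m -> option X}) (Z : {ffun 'I_m -> X}) : {ffun 'I_m -> X} :=
  [ffun i => if w i is Some y then y else Z i].

(** A single draw in which corruption, of probability [eta], is recorded as [None]. *)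
Definition thin (eta : R) (D : X -> R) (a : option X) : R :=
  if a is Some y then (1 - eta) * D y else eta.

Lemma prob_thin eta D : 0 <= eta <= 1 -> prob D -> prob (thin eta D).
Proof.
move=> /andP[e0 e1] [D0 D1]; split=> [[y|]|] //=; first by rewrite mulr_ge0 ?subr_ge0.
by rewrite sum_option /= -mulr_sumr D1 mulr1 addrC subrK.
Qed.

(* The adversary is granted full knowledge of the clean points. *)
Lemma malicious_le_fill eta (D : X -> R) A (g : {ffun 'I_m -> X} -> R) :
  0 <= eta <= 1 -> prob D -> mal_adversary A ->
  \sum_(x : {ffun 'I_m -> X})
     (\prod_(i < m) ((1 - eta) * D (x i) + eta * A i x (x i))) * g x
  <= pexp (fun=> thin eta D)
       (fun w => \big[Num.max/0]_(Z : {ffun 'I_m -> X}) g (fill w Z)).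
Proof.
move=> eta01 DP [AP Aad].
(* The law of one step is a mixture over its mark [a]: a point mass if clean, the adversary's choice
   if corrupted. *)
pose K (a : option X) i (x : {ffun 'I_m -> X}) (b : X) : R :=
  if a is Some y then (y == b)%:R else A i x b.
have E i (x : {ffun 'I_m -> X}) : (1 - eta) * D (x i) + eta * A i x (x i)
    = \sum_a thin eta D a * K a i x (x i).
  rewrite sum_option /= addrC (bigD1 (x i)) //= eqxx mulr1 big1 ?addr0 //.
  by move=> y /negbTE ->; rewrite mulr0.
under eq_bigr => x _.
  under eq_bigr => i _ do rewrite E.
  rewrite (bigA_distr_bigA (fun i a => thin eta D a * K a i x (x i))) mulr_suml.
  under eq_bigr => w _ do rewrite big_split /= -mulrA.
  over.
rewrite exchange_big /=; apply: ler_sum => w _; rewrite -mulr_sumr.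
apply: ler_wpM2l; first exact: (weight_ge0 (fun=> prob_thin eta01 DP)).
set M := \big[_/_]_Z _.
have K1 i h : \sum_b K (w i) i h b = 1.
  by rewrite /K; case: (w i) => [y|]; [case: (prob_delta R y)|case: (AP i h)].
have Kad : adapted (fun i => K (w i) i).
  move=> i h h' hh' b; rewrite /K; case: (w i) => //.
  by rewrite (Aad i h h').
rewrite -[leRHS]mul1r -(adapted_sum1 Kad K1) mulr_suml; apply: ler_sum => x _.
have K0 i b : 0 <= K (w i) i x b.
  by rewrite /K; case: (w i) => [y|]; [exact: ler0n|case: (AP i x)].
(* A sample that agrees with [w] at the clean positions is itself a filling of [w]; any other sample
   has weight zero. *)
have [e|/eqP] := eqVneq (fill w x) x.
  apply: ler_wpM2l; first by apply: prodr_ge0.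
  by rewrite -{1}e; exact: le_bigmax.
move=> /ffunP ne; have [i wi] : exists i, fill w x i != x i.
  apply/existsP; apply: contraT => /existsPn ex; exfalso.
  by apply: ne => i; have := ex i; rewrite negbK => /eqP.
rewrite (bigD1 i) //= {1 3}/K; move: wi; rewrite ffunE.
by case: (w i) => [y /negbTE ->|]; rewrite ?mul0r // eqxx.
Qed.

End SequentialSampling.

(** * Empirical measures and subsampling *)

Section EmpiricalMeasures.
Variables (R : realType) (X : finType).

Lemma pexp_delta (I : finType) (y : {ffun I -> X}) (h : {ffun I -> X} -> R) :
  pexp (fun i x => (y i == x)%:R) h = h y.
Proof.
rewrite /pexp (bigD1 y) //= big1 ?mul1r => [|i _]; last by rewrite eqxx.
rewrite big1 ?addr0 // => z zy.
have [i yi] : exists i, z i != y i.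
  apply/existsP; apply: contraT => /existsPn ex; case/eqP: zy.
  by apply/ffunP => i; have := ex i; rewrite negbK => /eqP.
by rewrite (bigD1 i) //= eq_sym (negbTE yi) !mul0r.
Qed.

(** [W] is the empirical law of [z] on [N]; for empty [N] both sides vanish and [D] serves as a
    default. *)
Lemma empirical_restrict m (N : pred 'I_m) (z : {ffun 'I_m -> X}) (D : X -> R) :
  prob D -> exists2 W : X -> R, prob W &
    forall x, \sum_(i | N i) (z i == x)%:R = #|N|%:R * W x.
Proof.
move=> DP; case: (posnP #|N|) => [N0|N0].
  exists D => // x; rewrite N0 mul0r big_pred0 // => i.
  by have := card0_eq N0 i.
have N0' : #|N|%:R != 0 :> R by rewrite pnatr_eq0 -lt0n.
exists (fun x => #|N|%:R^-1 * \sum_(i | N i) (z i == x)%:R); last first.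
  by move=> x; rewrite mulVKf.
split=> [x|].
  by rewrite mulr_ge0 ?invr_ge0 ?ler0n // sumr_ge0 // => i _; exact: ler0n.
rewrite -mulr_sumr exchange_big (eq_bigr (fun=> 1)) => [|i _].
  by rewrite sumr_const mulVf.
by case: (prob_delta R (z i)).
Qed.

Section Subsampling.
Variables (n m : nat) (f : {ffun 'I_n -> X} -> bool).
Hypotheses (m0 : (0 < m)%N) (nm : (n <= m)%N).

Let h (y : {ffun 'I_n -> X}) : R := ((f y) : nat)%:R.

Lemma h_unit_itv y : 0 <= h y <= 1.
Proof. by rewrite /h; case: (f y); rewrite ?lexx ?ler01. Qed.

(** Independent draws from the empirical measure of [x] sample its indices with replacement, while
    [compPhi] samples them without. *)
Lemma compPhi_unif (x : {ffun 'I_m -> X}) :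
  `|pexp (fun=> unif R x) h - compPhi R f x| <= n%:R ^+ 2 / m%:R.
Proof.
rewrite /unif pexp_avg /compPhi.
have E (s : {ffun 'I_n -> 'I_m}) :
    pexp (fun i a => (x (s i) == a)%:R) h = h [ffun i => x (s i)].
  by rewrite -[RHS]pexp_delta; apply: eq_pexp_mu => i a; rewrite ffunE.
under eq_bigr do rewrite E.
by apply: index_avg_injs => // s; exact: h_unit_itv.
Qed.

Lemma compPhi_pexp (mu : 'I_m -> X -> R) : (forall i, prob (mu i)) ->
  pexp mu (compPhi R f) = #|injs n m|%:R^-1 *
    \sum_(s in injs n m) pexp (fun i => mu (s i)) h.
Proof.
move=> muP; rewrite /compPhi pexpZ pexp_sum; congr (_ * _).
by apply: eq_bigr => s /injsP s_inj; rewrite -(pexp_marginal s_inj).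
Qed.

Lemma compPhi_pexp_avg (mu : 'I_m -> X -> R) : (forall i, prob (mu i)) ->
  `|pexp (fun=> avg mu) h - pexp mu (compPhi R f)| <= n%:R ^+ 2 / m%:R.
Proof.
move=> muP; rewrite pexp_avg compPhi_pexp //; apply: index_avg_injs => // s.
by apply: pexp_unit_itv => // y; exact: h_unit_itv.
Qed.

(** An injective index map reads independent coordinates, so subsampling i.i.d. points is exact. *)
Lemma compPhi_iid (D : X -> R) : prob D -> pexp (fun=> D) (@compPhi R X n m f) = pexp (fun=> D) h.
Proof.
move=> DP; rewrite compPhi_pexp // sumr_const -[pexp _ _ *+ _]mulr_natl mulKf //.
by rewrite pnatr_eq0 -lt0n card_injs ffact_gt0.
Qed.

Lemma compPhi_unit_itv (x : {ffun 'I_m -> X}) : 0 <= compPhi R f x <= 1.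
Proof.
apply/andP; split; first by rewrite mulr_ge0 ?invr_ge0 ?ler0n // sumr_ge0.
have J0 : (0 : R) < #|injs n m|%:R by rewrite ltr0n card_injs ffact_gt0.
rewrite ler_pdivrMl // mulr1 -sumr_const; apply: ler_sum => s _.
by case/andP: (h_unit_itv [ffun i => x (s i)]).
Qed.

End Subsampling.
End EmpiricalMeasures.

(** * Rounding of the number of clean points *)

Section CleanCount.
Variables (R : realType) (eta : R) (m : nat).
Hypothesis eta01 : 0 < eta < 1.

Lemma ceiln_itv : (1 - eta) * m%:R <= (ceiln ((1 - eta) * m%:R))%:R < (1 - eta) * m%:R + 1.
Proof.
have x0 : 0 <= (1 - eta) * m%:R.
  by rewrite mulr_ge0 ?ler0n // subr_ge0 ltW //; case/andP: eta01.
have c0 : 0 <= Num.ceil ((1 - eta) * m%:R) by rewrite ceil_ge0; apply: lt_le_trans x0; rewrite ltrN10.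
rewrite /ceiln natr_absz ger0_norm //.
have := ceil_itv ((1 - eta) * m%:R); rewrite intrB ltrBlDr => /andP[lt le].
by rewrite le lt.
Qed.

Lemma ceiln_le : (ceiln ((1 - eta) * m%:R) <= m)%N.
Proof.
rewrite -ltnS -(ltr_nat R) -natr1; case/andP: ceiln_itv => _ h; apply: lt_le_trans h _.
by rewrite lerD2r ler_piMl ?ler0n // gerBl ltW //; case/andP: eta01.
Qed.

End CleanCount.

(** * Clean points placed in the first positions *)

Section FixedPositions.
Variables (R : realType) (X : finType) (k m : nat).
Hypotheses (km : (k <= m)%N) (m0 : (0 < m)%N).

Lemma widen_codomE (i : 'I_m) : (i \notin codom (widen_ord km)) = (k <= i)%N.
Proof.
rewrite leqNgt; congr negb; apply/codomP/idP => [[j ->] //=|ik].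
by exists (Ordinal ik); apply: val_inj.
Qed.

Lemma card_notin_codom (tau : 'I_k -> 'I_m) : injective tau ->
  #|[pred i | i \notin codom tau]| = (m - k)%N.
Proof.
move=> tau_inj; have := cardC (mem (codom tau)).
rewrite card_codom // !card_ord => e; rewrite -[RHS](congr1 (subn^~ k) e) addKn.
exact: eq_card.
Qed.

Lemma widen_inj : injective (widen_ord km).
Proof. by move=> i j /(congr1 val) /= ?; apply: val_inj. Qed.

Definition clean_first (D E : X -> R) (i : 'I_m) : X -> R := if (i < k)%N then D else E.

Lemma avg_clean_first D E x :
  avg (clean_first D E) x = k%:R / m%:R * D x + (1 - k%:R / m%:R) * E x.
Proof.
have mN : m%:R != 0 :> R by rewrite pnatr_eq0 -lt0n.
rewrite /avg (big_codom_split widen_inj) /=.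
rewrite (eq_bigr (fun=> D x)) => [|j _]; last by rewrite /clean_first /= ltn_ord.
rewrite [X in _ + X](eq_bigr (fun=> E x)) => [|i]; last first.
  by rewrite widen_codomE /clean_first leqNgt => /negbTE ->.
rewrite !sumr_const card_ord card_notin_codom; last exact: widen_inj.
rewrite -[D x *+ k]mulr_natl -[E x *+ _]mulr_natl natrB //; by field.
Qed.

End FixedPositions.

(** * Inequalities between the four quantities *)

Section Comparison.
Variables (R : realType) (X : finType) (eta : R) (n m : nat).
Variables (f : {ffun 'I_n -> X} -> bool) (D : {ffun X -> R}).
Hypotheses (X0 : (0 < #|X|)%N) (eta01 : 0 < eta < 1) (DP : is_dist D).
Hypotheses (m0 : (0 < m)%N) (nm : (n <= m)%N).

Let h (y : {ffun 'I_n -> X}) : R := ((f y) : nat)%:R.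
Let f' := @compPhi R X n m f.
Let O := ObliviousAddMax eta f D.
Let DP' : prob D := DP.
Let mixf (W : X -> R) : X -> R := fun x => (1 - eta) * D x + eta * W x.

Let h01 y : 0 <= h y <= 1. Proof. exact: h_unit_itv. Qed.

Lemma prob_mixf W : prob W -> prob (mixf W).
Proof.
move=> [W0 W1]; case: DP' => D0 D1; split=> [x|].
  case/andP: eta01 => e0 e1.
  by rewrite /mixf addr_ge0 // mulr_ge0 // ?subr_ge0 ltW.
by rewrite big_split /= -!mulr_sumr D1 W1; ring.
Qed.

Lemma oblivious_ub W : prob W -> pexp (fun=> mixf W) h <= O.
Proof.
move=> WP; apply: ub_le_sup.
  exists 1 => _ [E [EP ->]].
  rewrite /expect_iid -/(pexp (fun=> mixd eta D E) h).
  rewrite (@eq_pexp_mu _ _ _ _ (fun=> mixf E)) => [|i x]; last by rewrite ffunE.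
  by case/andP: (pexp_unit_itv (fun=> prob_mixf EP) h01).
exists (finfun W); split.
  by split=> [x|]; [rewrite ffunE|under eq_bigr do rewrite ffunE]; case: WP.
by apply: (@eq_pexp_mu _ _ _ _ (fun=> mixd eta D (finfun W))) => i x; rewrite !ffunE.
Qed.

Lemma oblivious_le (B : R) :
  (forall E : {ffun X -> R}, prob E -> pexp (fun=> mixf E) h <= B) -> O <= B.
Proof.
move=> EB; apply: ge_sup; first by eexists; exists D.
move=> _ [E [EP ->]]; apply: le_trans (EB E EP).
rewrite le_eqVlt; apply/orP; left; apply/eqP.
by apply: (@eq_pexp_mu _ _ _ (fun=> mixd eta D E)) => i x; rewrite ffunE.
Qed.

(** The memoryless strategy that always plays [E] produces i.i.d. points of the mixture, on which
    subsampling is exact. *)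
Lemma oblivious_le_malicious : O <= MalMax eta f' D.
Proof.
apply: oblivious_le => E EP; rewrite -(compPhi_iid f nm (prob_mixf EP)).
apply: ub_le_sup; last first.
  by exists (fun _ _ => E); split=> //; split.
exists 1 => _ [A [[AP Aad] ->]].
(* The set of values is bounded by 1, because the sequential weights of any strategy sum to 1. *)
pose K i x b : R := (1 - eta) * D b + eta * A i x b.
have K1 i x : \sum_b K i x b = 1 by case: (prob_mixf (AP i x)).
have Kad : adapted K.
  by move=> i x x' xx' b; rewrite /K (Aad i x x').
rewrite -[leRHS](adapted_sum1 X0 Kad K1); apply: ler_sum => x _.
rewrite ler_piMr //; last by case/andP: (compPhi_unit_itv R f nm x).
by apply: prodr_ge0 => i _; case: (prob_mixf (AP i x)) => K0 _; exact: K0.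
Qed.

Let k := ceiln ((1 - eta) * m%:R).
Let km : (k <= m)%N. Proof. exact: ceiln_le. Qed.

Lemma noniid_le_adaptive : NonIIDMax eta f' D <= AdaptiveAddMax eta f' D.
Proof.
apply: ge_sup.
  (* An arbitrary arrangement, showing that the supremum is over a nonempty set. *)
  exists (expect_iid D (fun S => f' (Defs.merge [ffun j => widen_ord km j] S
    [ffun=> enum_val (Ordinal X0)]))).
  do 2 eexists; split; last by [].
  by move=> i j; rewrite !ffunE; exact: widen_inj.
move=> _ [tau [Z [tau_inj ->]]].
apply: (ler_pexp (mu := fun=> D)) => // S.
apply: (le_bigmax_cond _ (fun tZ => f' (Defs.merge tZ.1 S tZ.2)) (j := (tau, Z))).
exact/injectiveP.
Qed.

(** Rounding moves the clean fraction [k / m] by at most [1 / m] from [1 - eta], hence the mixture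
    by at most [2 / m] in total. *)
Lemma clean_first_close W : prob W ->
  `|pexp (fun=> avg (clean_first k D W : 'I_m -> _)) h - pexp (fun=> mixf W) h|
  <= 2 * n%:R / m%:R.
Proof.
move=> WP; have m0' : (0 : R) < m%:R by rewrite ltr0n.
have cP (i : 'I_m) : prob (clean_first k D W i) by rewrite /clean_first; case: ifP.
apply: le_trans (pexp_lip_iid (prob_avg m0 cP) (prob_mixf WP) h01) _.
rewrite -mulrA mulrCA ler_wpM2l ?ler0n //.
rewrite (eq_bigr (fun x => `|k%:R / m%:R - (1 - eta)| * `|D x - W x|)) => [|x _].
  rewrite -mulr_sumr mulrC; apply: ler_pM; rewrite ?sumr_ge0 // ?dist_prob_le2 //.
  rewrite ler_norml lerBlDr lerBrDr ler_pdivrMr // ler_pdivlMr //.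
  rewrite !mulrDl mulNr mulVf ?gt_eqF //.
  by have := ceiln_itv m eta01; rewrite -/k mulrBl; lra.
rewrite avg_clean_first // -normrM /mixf; congr (`| _ |); ring.
Qed.

Lemma oblivious_le_noniid :
  O <= NonIIDMax eta f' D + n%:R ^+ 2 / m%:R + 2 * n%:R / m%:R.
Proof.
apply: oblivious_le => E EP.
have cP (i : 'I_m) : prob (clean_first k D E i) by rewrite /clean_first; case: ifP.
have := clean_first_close EP; have := compPhi_pexp_avg f m0 nm cP.
have : pexp (clean_first k D E) f' <= NonIIDMax eta f' D.
  have winj := @widen_inj k m km.
  rewrite -(pexp_overwrite winj f' cP).
  (* With the corrupted points drawn from [E], some fixed [Z] does at least as well as the average,
     and the adversary plays that [Z]. *)
  have [Z hZ] := pexp_exists cP (fun w => pexp (fun j : 'I_k => clean_first k D E (widen_ord km j))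
    (fun S => f' (overwrite (widen_ord km) S w))) [ffun=> enum_val (Ordinal X0)].
  apply: le_trans hZ _; apply: ub_le_sup.
    exists 1 => _ [tau [Z' [_ ->]]].
    by apply: (pexp_le (mu := fun=> D)) => // S; case/andP: (compPhi_unit_itv R f nm (Defs.merge tau S Z')).
  exists [ffun j => widen_ord km j], Z; split=> [i j|]; first by rewrite !ffunE; exact: winj.
  rewrite (@eq_pexp_mu _ _ _ _ (fun=> D)) => [|j x]; last by rewrite /clean_first /= ltn_ord.
  apply: eq_pexp => S; congr f'; apply/ffunP => i; rewrite !ffunE.
  by rewrite [in RHS](@eq_pick _ _ (fun j => widen_ord km j == i)) // => j; rewrite ffunE.
rewrite !ler_norml => H1 /andP[_ H2] /andP[H3 _]; move: H1 H2 H3.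
by rewrite -/h -/f'; lra.
Qed.

Variables (t : nat) (lam : R).
Hypotheses (t0 : (0 < t)%N) (l0 : 0 < lam) (lc : lam * (2 * n%:R / m%:R) <= 2^-1).

Let d : R := n%:R ^+ 2 / m%:R.
Let err : R := d + n%:R ^+ 2 / t%:R + t%:R * ln #|X|%:R / lam
               + 2 * lam * (2 * n%:R / m%:R) ^+ 2 * m%:R.

(* By permutation invariance of subsampling only the empirical measure of the
   corrupted points matters, so the clean points may be placed first. *)
Lemma adaptive_le_oblivious : AdaptiveAddMax eta f' D <= O + 2 * n%:R / m%:R + d + err.
Proof.
have winj := @widen_inj k m km.
(* The clean sample is embedded into [m] independent coordinates, of which only the first [k] are
   revealed. *)
pose c (i : 'I_m) (a : X) := if (i < k)%N then Some a else None.
rewrite /AdaptiveAddMax -/k /expect_iid.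
pose M (S : {ffun 'I_k -> X}) := \big[Num.max/0]_(tZ : {ffun 'I_k -> 'I_m} * {ffun 'I_m -> X}
                      | injectiveb tZ.1) f' (Defs.merge tZ.1 S tZ.2).
rewrite -/(pexp (fun=> D) M) -(pexp_marginal winj M (fun=> DP')).
(* The shift by [d] pays for passing from [f'] to independent draws from the empirical measure. *)
have := @pexp_complete_le R X X m c n t (fun=> D) h
  (fun w => M [ffun j => w (widen_ord km j)] + - d) lam (O + 2 * n%:R / m%:R)
  m0 t0 X0 l0 lc (fun=> DP') h01.
rewrite pexpD pexp_cst // => H; rewrite addrAC -lerBlDr /err !addrA; apply: H => [w|W WP].
  set S := [ffun j => w (widen_ord km j)].
  (* This property holds at 0 and is stable under [Num.max], so it passes from single arrangements
     to the big maximum. *)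
  pose attainable v := exists2 W, prob W &
      v <= pexp (fun=> avg (fun i => complete c W i (w i))) h + d.
  have : attainable (M S).
    rewrite /M; apply: (big_ind attainable) => [|x y [V VP xV] [W WP yW]|[tau Z] /injectiveP tau_inj].
    - exists D => //; rewrite addr_ge0 ?divr_ge0 ?exprn_ge0 ?ler0n // pexp_ge0 //.
      by move=> _; apply: prob_avg => // i; exact: (prob_complete _ _ _ DP').
    - by rewrite /attainable maxEle; case: ifP => _; [exists W|exists V].
    - set x := Defs.merge _ _ _ => /=.
      have [W WP xW] := empirical_restrict [pred i | i \notin codom tau] x DP'.
      exists W => //.
      have := compPhi_unif R f m0 nm x; rewrite ler_norml lerBrDl => /andP[+ _].
      rewrite -/h -/f' -/d lerBlDr.
      rewrite (@eq_pexp_mu _ _ _ (fun=> unif R x) (fun=> avg (fun i => complete c W i (w i)))) //.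
      move=> _ y; rewrite /unif /avg; congr (_ * _).
      (* One side is split along the positions [tau], the other along the first [k]: the clean
         points match, and both leave [m - k] corrupted positions. *)
      rewrite (big_codom_split tau_inj) /= xW (big_codom_split winj) /=.
      congr (_ + _).
        apply: eq_bigr => j _; rewrite /complete /c /= ltn_ord.
        by rewrite [x]/(overwrite tau S Z) (overwrite_in tau_inj) ffunE.
      rewrite (eq_bigr (fun=> W y)) => [|i]; last first.
        by rewrite widen_codomE /complete /c leqNgt => /negbTE ->.
      rewrite sumr_const mulr_natl; congr (_ *+ _).
      by rewrite (card_notin_codom tau_inj) (card_notin_codom winj).
  by move=> [W WP xW]; exists W => //; rewrite lerBlDr.
have := clean_first_close WP; rewrite ler_norml => /andP[_]; rewrite lerBlDl.
rewrite (@eq_pexp_mu _ _ _ (fun=> avg (clean_first k D W : 'I_m -> _))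
  (fun=> avg (fun i x => \sum_a D a * complete c W i a x))) => [cf|_ x].
  by apply: le_trans cf _; rewrite lerD2r; exact: oblivious_ub.
congr (_ * _); apply: eq_bigr => i _; rewrite /clean_first /complete /c.
case: ifP => _; last by rewrite -mulr_suml; case: DP' => _ ->; rewrite mul1r.
rewrite (bigD1 x) //= eqxx mulr1 big1 ?addr0 // => y /negbTE ->.
by rewrite mulr0.
Qed.

(** Positions are corrupted independently with probability exactly [eta], so the mean completion is
    the oblivious mixture itself and no rounding term appears. *)
Lemma malicious_le_oblivious : MalMax eta f' D <= O + d + err.
Proof.
have eta01' : 0 <= eta <= 1 by case/andP: eta01 => e0 e1; rewrite !ltW.
apply: ge_sup; first by eexists; exists (fun _ _ => D); split => //; split.
move=> _ [A [AP ->]]; apply: le_trans (malicious_le_fill X0 _ eta01' DP' AP) _.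
have TP := prob_thin eta01' DP'.
pose c (i : 'I_m) (a : option X) := a.
pose M (w : {ffun 'I_m -> option X}) := \big[Num.max/0]_(Z : {ffun 'I_m -> X}) f' (fill w Z).
have := @pexp_complete_le R X _ m c n t (fun=> thin eta D) h
  (fun w => M w + - d) lam O m0 t0 X0 l0 lc (fun=> TP) h01.
rewrite pexpD pexp_cst // => H; rewrite addrAC -lerBlDr /err !addrA; apply: H => [w|W WP].
  pose attainable v := exists2 W, prob W &
      v <= pexp (fun=> avg (fun i => complete c W i (w i))) h + d.
  have : attainable (M w).
    rewrite /M; apply: (big_ind attainable) => [|x y [V VP xV] [W WP yW]|Z _].
    - exists D => //; rewrite addr_ge0 ?divr_ge0 ?exprn_ge0 ?ler0n // pexp_ge0 //.
      by move=> _; apply: prob_avg => // i; exact: (prob_complete _ _ _ DP').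
    - by rewrite /attainable maxEle; case: ifP => _; [exists W|exists V].
    - set x := fill _ _.
      have [W WP xW] := empirical_restrict [pred i | w i == None] x DP'.
      exists W => //.
      have := compPhi_unif R f m0 nm x; rewrite ler_norml lerBrDl => /andP[+ _].
      rewrite -/h -/f' -/d lerBlDr.
      rewrite (@eq_pexp_mu _ _ _ (fun=> unif R x) (fun=> avg (fun i => complete c W i (w i)))) //.
      move=> _ y; rewrite /unif /avg; congr (_ * _).
      rewrite (bigID [pred i | w i == None]) [RHS](bigID [pred i | w i == None]) /= xW.
      congr (_ + _).
        rewrite (eq_bigr (fun=> W y)) => [|i /eqP wi]; last by rewrite /complete /c wi.
        by rewrite sumr_const mulr_natl.
      by apply: eq_bigr => i; rewrite /complete /c ffunE; case: (w i).
  by move=> [W WP xW]; exists W => //; rewrite lerBlDr.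
rewrite (@eq_pexp_mu _ _ _ _ (fun=> mixf W)) => [|_ x]; first exact: oblivious_ub.
rewrite /avg /complete /c mean_cst // sum_option /= addrC; congr (_ + _).
by rewrite (bigD1 x) //= eqxx mulr1 big1 ?addr0 // => y /negbTE ->; rewrite mulr0.
Qed.

End Comparison.

(** * Choice of parameters and conclusion *)

Lemma sample_size_parameters (R : realType) (n m : nat) (eps l L : R) :
  (1 <= n)%N -> 0 < eps < 1 -> 0 < L -> l <= L ->
  72 * 64 * n%:R ^+ 4 * eps^-1 ^+ 3 * L + 64 * n%:R ^+ 2 * eps^-1 <= m%:R ->
  [/\ (n <= m)%N, n%:R ^+ 2 / m%:R <= eps / 64, 2 * n%:R / m%:R <= eps / 32 &
   exists (t : nat) (lam : R), [/\ (0 < t)%N, 0 < lam, lam * (2 * n%:R / m%:R) <= 2^-1 &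
   n%:R ^+ 2 / t%:R + t%:R * l / lam + 2 * lam * (2 * n%:R / m%:R) ^+ 2 * m%:R
     <= 3 / 8 * eps]].
Proof.
move=> n1 /andP[e0 e1] L0 lL; set E := eps^-1.
have E0 : 0 < E by rewrite invr_gt0.
have eE : eps * E = 1 by rewrite mulfV ?gt_eqF.
have E1 : 1 < E by rewrite invf_gt1.
clearbody E.
have N1 : 1 <= n%:R :> R by rewrite ler1n.
set N : R := n%:R in N1 *; set M : R := m%:R => mM.
have N0 : 0 < N by apply: lt_le_trans N1.
have p1 : 0 < N ^+ 4 * E ^+ 3 * L by rewrite !mulr_gt0 ?exprn_gt0.
have p2 : 0 < N ^+ 2 * E by rewrite mulr_gt0 ?exprn_gt0.
have NM2 : 64 * N ^+ 2 * E <= M by lra.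
have NM4 : 72 * 64 * N ^+ 4 * E ^+ 3 * L <= M by lra.
have M0 : 0 < M by lra.
have NN : N <= N ^+ 2 by rewrite expr2 ler_peMl // ltW.
have q1 : N ^+ 2 / M <= eps / 64.
  rewrite ler_pdivrMr //.
  apply: (@le_trans _ _ (eps / 64 * (64 * N ^+ 2 * E))); last by rewrite ler_wpM2l // divr_ge0 // ltW.
  have -> : eps / 64 * (64 * N ^+ 2 * E) = eps * E * N ^+ 2 by field.
  by rewrite eE mul1r.
have q2 : N / M <= N ^+ 2 / M by rewrite ler_wpM2r // invr_ge0 ltW.
split=> //.
- rewrite -(ler_nat R) -/N -/M; apply: le_trans NN _.
  have : N ^+ 2 <= N ^+ 2 * E by apply: ler_peMr; [exact: exprn_ge0 (ltW N0)|exact: ltW].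
  lra.
- by rewrite -mulrA; lra.
have x0 : 0 <= 8 * N ^+ 2 * E by rewrite ltW // -mulrA mulr_gt0.
(* The least integer above [8 * N ^+ 2 / eps], which brings the discretization error below
   [eps / 8]. *)
exists (Num.truncn (8 * N ^+ 2 * E)).+1.
case/andP: (truncn_itv x0); set t : R := (Num.truncn (8 * N ^+ 2 * E)).+1%:R => tl tr.
have t0 : 0 < t by rewrite ltr0n.
have tE : t <= 9 * N ^+ 2 * E.
  rewrite /t -[leLHS]natr1; apply: (@le_trans _ _ (8 * N ^+ 2 * E + 1)); first by rewrite lerD2r.
  have : 1 <= N ^+ 2 * E by apply: le_trans (ltW E1) _; apply: ler_peMl; [exact: ltW|exact: exprn_ege1].
  lra.
(* This choice makes the entropy term at most [eps / 8]. Since [t <= 9 * N ^+ 2 * E], it is at most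
   [72 * N ^+ 2 * L * E ^+ 2], whence the constant [72 * 64] in the bound on [m]. *)
exists (8 * t * L * E).
have l0 : 0 < 8 * t * L * E by rewrite !mulr_gt0.
have lE : 8 * t * L * E <= 72 * N ^+ 2 * L * E ^+ 2.
  have : t * (L * E) <= 9 * N ^+ 2 * E * (L * E) by rewrite ler_wpM2r // mulr_ge0 // ltW.
  rewrite [E ^+ 2]expr2; lra.
have lM : 8 * t * L * E * (N ^+ 2 / M) <= eps / 64.
  rewrite mulrA ler_pdivrMr //.
  apply: (@le_trans _ _ (72 * N ^+ 2 * L * E ^+ 2 * N ^+ 2)).
    by rewrite ler_wpM2r // exprn_ge0 // ltW.
  apply: (@le_trans _ _ (eps / 64 * (72 * 64 * N ^+ 4 * E ^+ 3 * L))); last first.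
    by rewrite ler_wpM2l // divr_ge0 ?ler0n // ltW.
  have -> : eps / 64 * (72 * 64 * N ^+ 4 * E ^+ 3 * L)
      = eps * E * (72 * N ^+ 2 * L * E ^+ 2 * N ^+ 2) by field.
  by rewrite eE mul1r.
split=> //.
- have : 8 * t * L * E * (N / M) <= 8 * t * L * E * (N ^+ 2 / M) by rewrite ler_wpM2l // ltW.
  by move: lM; rewrite -/M; set a := N / M; rewrite -[2 * N / M]mulrA -/a; lra.
have u1 : N ^+ 2 / t <= eps / 8.
  rewrite ler_pdivrMr //.
  apply: (@le_trans _ _ (eps / 8 * (8 * N ^+ 2 * E))); last by rewrite ler_wpM2l ?divr_ge0 // ltW.
  have -> : eps / 8 * (8 * N ^+ 2 * E) = eps * E * N ^+ 2 by field.
  by rewrite eE mul1r.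
have u2 : t * l / (8 * t * L * E) <= eps / 8.
  rewrite ler_pdivrMr // (_ : eps / 8 * _ = (eps * E) * (t * L)); last by field.
  by rewrite eE mul1r ler_wpM2l // ltW.
have -> : 2 * (8 * t * L * E) * (2 * N / M) ^+ 2 * M = 8 * (8 * t * L * E * (N ^+ 2 / M)).
  by field; rewrite gt_eqF.
have -> : 3 / 8 * eps = eps / 8 + eps / 8 + 8 * (eps / 64) by field.
by apply: lerD; [exact: lerD|rewrite ler_wpM2l].
Qed.

Theorem mainTheorem19 (R : realType) :
  exists p : poly3 R,
  forall (X : finType) (eta eps : R) (n : nat) (f : {ffun 'I_n -> X} -> bool)
         (D : {ffun X -> R}) (m : nat),
    (0 < #|X|)%N ->
    0 < eta < 1 -> 0 < eps < 1 -> (1 <= n)%N ->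
    is_dist D ->
    peval3 p n%:R eps^-1 (ln (#|X|%:R + 1)) <= m%:R ->
    let f' := @compPhi R X n m f in
    let qs := [:: ObliviousAddMax eta f D; AdaptiveAddMax eta f' D;
                  MalMax eta f' D; NonIIDMax eta f' D] in
    forall a b, a \in qs -> b \in qs -> `|a - b| <= eps.
Proof.
exists [:: (72 * 64, (4, 3, 1)%N); (64, (2, 1, 0)%N)].
move=> X eta eps n f D m X0 eta01 eps01 n1 DP mL f'; cbv zeta; rewrite {}/f'.
move: mL; rewrite /peval3 big_cons big_seq1 /= !expr1 expr0 mulr1 => mL.
have X0' : (0 : R) < #|X|%:R by rewrite ltr0n.
(* The added 1 keeps the logarithm, and with it [lam], positive when [X] has a single point. *)
have L0 : 0 < ln (#|X|%:R + 1) :> R by rewrite ln_gt0 // ltrDr.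
have lL : ln #|X|%:R <= ln (#|X|%:R + 1) :> R.
  by rewrite ler_ln ?posrE ?lerDl // addr_gt0.
have [nm d1 d2 [t [lam [t0 l0 lc err]]]] := sample_size_parameters n1 eps01 L0 lL mL.
have m0 : (0 < m)%N by apply: leq_trans nm.
have OM := oblivious_le_malicious f X0 eta01 DP nm.
have NA := noniid_le_adaptive m f X0 eta01 DP.
have ON := oblivious_le_noniid f X0 eta01 DP m0 nm.
have AO := adaptive_le_oblivious f X0 eta01 DP m0 nm t0 l0 lc.
have MO := malicious_le_oblivious f X0 eta01 DP m0 nm t0 l0 lc.
case/andP: eps01 => e0 e1.
move: (ObliviousAddMax _ _ _) (AdaptiveAddMax _ _ _) (MalMax _ _ _)
  (NonIIDMax _ _ _) OM NA ON AO MO => O A M N OM NA ON AO MO a b.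
(* With these bounds [O - eps / 2 <= N <= A <= O + eps / 2] and [O <= M <= O + eps / 2], so all four
   values lie in an interval of length [eps]. *)
have {}ON : O <= N + eps / 2 by apply: le_trans ON _; lra.
have {}AO : A <= O + eps / 2 by apply: le_trans AO _; lra.
have {}MO : M <= O + eps / 2 by apply: le_trans MO _; lra.
clear -e0 OM NA ON AO MO.
rewrite !inE ler_norml => /or4P[] /eqP -> /or4P[] /eqP ->; lra.
Qed.
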